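(* Let $G$ be a connected simple graph with at least $2$ vertices, with $n$ vertices, maximum degree $\Delta$, and spectral moments $M_2, M_4$. Put $$A=\frac{M_4}{\Delta^3},\qquad B=\frac{M_2}{\Delta},\qquad C=\Delta n .$$ Then $$E(G)\le -\frac{B^2+B\sqrt{-A+B}\sqrt{-B+C}-C\left(A+\sqrt{-A+B}\sqrt{-B+C}\right)}{A-2B+C},$$ with equality if and only if $G$ is a complete graph $K_n$, a strongly regular graph with parameters satisfying $\lambda=\mu$, or the incidence graph of a symmetric $2$-$(v,k,\lambda)$ design.
   Context: All graphs are simple and finite. The adjacency eigenvalues $\lambda_1,\dots,\lambda_n$ of $G$ are the eigenvalues of its (symmetric) adjacency matrix. The energy of $G$ is $E(G)=\sum_{i=1}^n|\lambda_i|$. The $k$-th spectral moment is $M_k=\sum_{i=1}^n\lambda_i^k=\operatorname{Tr}(\mathrm{Adj}^k)$; thus $M_2=2m$ where $m$ is the number of edges, and $M_4=2\sum_i d_i^2-2m+8Q$, where $d_i$ are the vertex degrees and $Q$ is the number of $4$-cycles. A strongly regular graph with parameters $\lambda,\mu$ is a regular graph in which every two adjacent vertices have exactly $\lambda$ common neighbours and every two non-adjacent vertices have exactly $\mu$ common neighbours. A symmetric $2$-$(v,k,\lambda)$ design is a set $X$ of $v$ points with a family $F$ of $v$ subsets (blocks) of $X$, each of size $k$, such that any two distinct points lie in exactly $\lambda$ common blocks; its incidence graph has vertex set $F\cup X$, with a block $B$ adjacent to a point $x$ iff $x\in B$.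
   Formalization: For G = K_2 one has A = B = C = 2 and the right-hand side is 0/0; the bound and equality case are stated only when A-2B+C is nonzero, which is proved to fail exactly for n = 2. The blocks of a design form an indexed family (repeats allowed). *)

(* Defs.v *)
From HB Require Import structures.
From mathcomp Require Import all_boot all_order all_algebra.
From mathcomp Require Import polyrcf.

Set Implicit Arguments.
Unset Strict Implicit.
Unset Printing Implicit Defensive.

Import Order.TTheory GRing.Theory Num.Theory.

Local Open Scope ring_scope.

Record sgraph := SGraph {
  vertex :> finType;
  adj : rel vertex;
  adj_sym : symmetric adj;
  adj_irrefl : irreflexive adj }.

Arguments adj {s}.

Definition neighbours (G : sgraph) (x : G) : {set G} := [set y | adj x y].

Definition degree (G : sgraph) (x : G) : nat := #|neighbours x|.

Definition max_degree (G : sgraph) : nat := \max_(x : G) degree x.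

Definition connected (G : sgraph) : Prop := forall x y : G, connect adj x y.

Definition isomorphic (G H : sgraph) : Prop :=
  exists2 f : G -> H, bijective f & forall x y, adj (f x) (f y) = adj x y.

Definition adjacency_mx (R : nzRingType) (G : sgraph) : 'M[R]_#|G| :=
  \matrix_(i, j) (adj (enum_val i) (enum_val j))%:R.

(* The real roots of the characteristic polynomial, each repeated according to
   its multiplicity. The adjacency matrix is symmetric, so all its eigenvalues
   are real and this sequence has #|G| terms. *)
Definition eigenvalues (R : rcfType) (G : sgraph) : seq R :=
  let p := char_poly (adjacency_mx R G) in
  flatten [seq nseq (mup x p) x | x <- rootsR p].

Definition energy (R : rcfType) (G : sgraph) : R :=
  \sum_(x <- eigenvalues R G) `|x|.

Definition spectral_moment (R : rcfType) (G : sgraph) (k : nat) : R :=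
  \sum_(x <- eigenvalues R G) x ^+ k.

Definition complete (G : sgraph) : Prop := forall x y : G, x != y -> adj x y.

Definition regular (G : sgraph) : Prop :=
  exists k : nat, forall x : G, degree x = k.

Definition strongly_regular (G : sgraph) (lambda mu : nat) : Prop :=
  [/\ regular G,
      forall x y : G, adj x y ->
        #|neighbours x :&: neighbours y| = lambda
    & forall x y : G, x != y -> ~~ adj x y ->
        #|neighbours x :&: neighbours y| = mu].

(* The blocks are an indexed family, so repeated blocks are allowed. This only
   matters for k = v, where the incidence graph is the complete bipartite graph
   with parts of size v. *)
Definition symmetric_design (X F : finType) (blk : F -> {set X})
    (v k lambda : nat) : Prop :=
  [/\ #|X| = v, #|F| = v, forall B : F, #|blk B| = k
    & forall x y : X, x != y ->
        #|[set B | (x \in blk B) && (y \in blk B)]| = lambda].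

Definition incidence (X F : finType) (blk : F -> {set X}) : rel (F + X) :=
  fun a b => match a, b with
             | inl B, inr x => x \in blk B
             | inr x, inl B => x \in blk B
             | _, _ => false
             end.

Lemma incidence_sym (X F : finType) (blk : F -> {set X}) :
  symmetric (incidence blk).
Proof. by case=> a [] b. Qed.

Lemma incidence_irrefl (X F : finType) (blk : F -> {set X}) :
  irreflexive (incidence blk).
Proof. by case. Qed.

Definition incidence_graph (X F : finType) (blk : F -> {set X}) : sgraph :=
  SGraph (incidence_sym blk) (incidence_irrefl blk).

Definition is_symmetric_design_graph (G : sgraph) : Prop :=
  exists (X F : finType) (blk : F -> {set X}) (v k lambda : nat),
    symmetric_design blk v k lambda /\ isomorphic G (incidence_graph blk).

(* Main.v *)
Require Import Defs.
From mathcomp Require Import all_boot all_order all_algebra.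
From mathcomp Require Import polyrcf complex spectral sesquilinear.
From mathcomp Require Import ring lra zify.
Set Implicit Arguments.
Unset Strict Implicit.
Unset Printing Implicit Defensive.
Import Order.TTheory GRing.Theory Num.Theory.
Local Open Scope ring_scope.

(* With y = |lambda| / Delta in [0, 1] and t ^+ 2 = (B - A) / (C - B), the bound
   is (B + t C) / (1 + t), and it follows by summing
     (y - t) ^+ 2 (1 - y) (y + 2 t + 1) >= 0
   over the eigenvalues. Equality means that y is always t or 1, that is
   (M ^+ 2 - Delta ^+ 2) (M ^+ 2 - b) = 0 for the adjacency matrix M and some b.
   Then M ^+ 2 fixes the columns of K = M ^+ 2 - b up to the factor Delta ^+ 2,
   and the Dirichlet form of the two-step walk forces these columns to be
   constant on the classes of vertices joined by walks of even length, and G to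
   be regular. So any two vertices of a class have the same number of common
   neighbours. There is one class (strongly regular graph with lambda = mu) or
   there are two (incidence graph of a symmetric design). *)

(** * Spectra of real symmetric matrices *)

Section Spectrum.
Variable R : rcfType.

(* eigenvalues R G unfolds to real_spectrum (adjacency_mx R G). *)
Definition real_spectrum n (M : 'M[R]_n) : seq R :=
  let p := char_poly M in
  flatten [seq nseq (mup x p) x | x <- rootsR p].

(** The multiplicity of a root of the product is its count in [s], so any splitting into linear
    factors lists the spectrum. *)
Lemma perm_real_roots (p : {poly R}) (s : seq R) :
  p = \prod_(x <- s) ('X - x%:P) ->
  perm_eq (flatten [seq nseq (mup x p) x | x <- rootsR p]) s.
Proof.
move=> pE; have p0 : p != 0.
  by rewrite pE prodf_seq_neq0; apply/allP => x _; rewrite polyXsubC_eq0.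
apply/allP => x _; apply/eqP; rewrite count_flatten -map_comp sumnE big_map /=.
under eq_bigr do rewrite count_nseq /=.
rewrite -(mu_prod_XsubC x s) -pE.
have [xr|xNr] := boolP (x \in rootsR p).
  rewrite (bigD1_seq x) ?uniq_roots //= eqxx mul1n big1 ?addn0 // => y.
  by move=> /negPf ->.
rewrite mupNroot; first rewrite big1_seq // => y /andP[_ yr].
  by case: eqP => // yx; rewrite -yx yr in xNr.
by have := roots_on_rootsR p0 x; rewrite in_itv /= => ->.
Qed.

(** A real symmetric matrix is hermitian over [R[i]], hence diagonalizable there with real
    eigenvalues. The factorization of the characteristic polynomial descends to [R]; the conjugating
    [P] stays complex, which suffices for traces and for vanishing. *)
Lemma symmetric_diagonalization n (M : 'M[R]_n) : M^T = M ->
  exists2 d : 'rV[R]_n, char_poly M = \prod_i ('X - (d 0 i)%:P)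
    & exists2 P : 'M[R[i]]_n, P \in unitmx
    & map_mx (real_complex R) M
      = invmx P *m diag_mx (map_mx (real_complex R) d) *m P.
Proof.
move=> Msym; set MC := map_mx _ M.
have MCreal : MC \is a mxOver Num.real.
  by apply/mxOverP => i j; rewrite mxE complex_real.
have MCherm : MC \is hermsymmx.
  apply: realsym_hermsym => //; apply/is_hermitianmxP.
  by rewrite expr0 scale1r map_mx_id // /MC map_trmx Msym.
have /orthomx_spectralP MCE := hermitian_normalmx MCherm.
have /mxOverP Dreal := hermitian_spectral_diag_real MCherm.
pose d : 'rV[R]_n := map_mx (@complex.Re R) (spectral_diag MC).
have dE : spectral_diag MC = map_mx (real_complex R) d.
  apply/matrixP => i j; rewrite !mxE.
  by have := Dreal i j; case: (spectral_diag MC i j) => a b; rewrite complex_real => /eqP ->.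
set P := spectralmx MC in MCE; have Pu : P \in unitmx := spectral_unit MC.
rewrite dE in MCE; exists d; last by exists P.
apply: (map_poly_inj (real_complex R)).
rewrite map_char_poly -/MC rmorph_prod /=.
have -> : char_poly MC = char_poly (diag_mx (map_mx (real_complex R) d)).
  rewrite /char_poly /char_poly_mx {1}MCE !map_mxM /=.
  set Q := map_mx _ P; set QV := map_mx _ (invmx P); set D := map_mx _ (diag_mx _).
  have QVQ : QV *m Q = 1%:M by rewrite -map_mxM mulVmx // map_mx1.
  have -> : 'X%:M - QV *m D *m Q = QV *m ('X%:M - D) *m Q.
    by rewrite mulmxBr mulmxBl scalar_mxC -[X in _ = X - _]mulmxA QVQ scalar_mxC mul1mx.
  by rewrite !det_mulmx mulrAC -det_mulmx QVQ det1 mul1r.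
rewrite char_poly_trig ?diag_mx_is_trig //; apply: eq_bigr => i _.
by rewrite rmorphB /= map_polyX map_polyC /= !mxE eqxx mulr1n.
Qed.

Lemma symmetric_real_spectrum n (M : 'M[R]_n) : M^T = M ->
  size (real_spectrum M) = n.
Proof.
move=> /symmetric_diagonalization [d charM _].
rewrite (perm_size (perm_real_roots (s := [seq d 0 i | i <- enum 'I_n]) _)).
  by rewrite size_map size_enum_ord.
by rewrite big_map big_enum.
Qed.

(** [p(M)] is conjugate to the diagonal matrix of the values of [p] on the spectrum, and both claims
    are read off that diagonal. The size is a successor so that the matrices form a nonzero ring for
    [horner_mx]. *)
Lemma symmetric_spectral_map n (M : 'M[R]_n.+1) (p : {poly R}) : M^T = M ->
  \sum_(x <- real_spectrum M) p.[x] = \tr (horner_mx M p) /\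
  (horner_mx M p = 0 <-> forall x, x \in real_spectrum M -> p.[x] = 0).
Proof.
move=> /symmetric_diagonalization [d charM [P Pu ME]].
have specE : perm_eq (real_spectrum M) [seq d 0 i | i <- enum 'I_n.+1].
  by apply: perm_real_roots; rewrite big_map big_enum.
have pME : map_mx (real_complex R) (horner_mx M p)
    = invmx P *m map_mx (real_complex R) (diag_mx (map_mx (horner p) d)) *m P.
  by rewrite map_horner_mx ME horner_mx_uconjC // -map_diag_mx -map_horner_mx horner_mx_diag.
split.
  rewrite (perm_big _ specE) big_map big_enum /=.
  apply: (@complexI R); rewrite -trace_map_mx pME mxtrace_mulC mulmxA mulmxV //.
  rewrite mul1mx trace_map_mx mxtrace_diag; congr (real_complex R _).
  by apply: eq_bigr => i _; rewrite mxE.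
split=> [pM0 x | px0].
  rewrite (perm_mem specE) => /mapP[i _ ->].
  move: pME; rewrite pM0 map_mx0 => /(congr1 (fun A => P *m A *m invmx P)).
  rewrite mulmx0 mul0mx !mulmxA mulmxV // mul1mx mulmxK // => /matrixP/(_ i i).
  rewrite !mxE eqxx mulr1n => /esym e; apply: (@complexI R); exact: e.
apply: (map_mx_inj (f := real_complex R)); rewrite pME.
suff -> : diag_mx (map_mx (horner p) d) = 0 by rewrite map_mx0 mulmx0 mul0mx.
apply/matrixP => i j; rewrite !mxE px0 ?mul0rn // (perm_mem specE).
by apply: map_f; rewrite mem_enum.
Qed.

Lemma symmetric_spectrum_square n (M : 'M[R]_n) a : M^T = M ->
  (M *m M = a%:M <-> forall x, x \in real_spectrum M -> x ^+ 2 = a).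
Proof.
case: n M => [|n] M Msym.
  split=> _; last by apply/matrixP => -[].
  by move=> x; have /size0nil -> := symmetric_real_spectrum Msym.
have [_] := symmetric_spectral_map ('X^2 - a%:P) Msym.
rewrite rmorphB rmorphXn /= horner_mx_X horner_mx_C expr2 => pE.
split=> [MM x | xa].
  by move=> xs; have := pE.1; rewrite -mulmxE MM subrr => /(_ erefl _ xs);
    rewrite !hornerE => /subr0_eq.
apply/subr0_eq/pE => x /xa; rewrite !hornerE => ->; exact: subrr.
Qed.

(** [F] is the value at [M] of [('X^2 - a) * ('X^2 - b)], so the trace of [F *m F] is a sum of
    squares over the spectrum. *)
Lemma symmetric_spectrum_two_squares n (M : 'M[R]_n) a b : M^T = M ->
  let F := (M *m M - a%:M) *m (M *m M - b%:M) in
  (\tr (F *m F) = 0 -> F = 0) /\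
  (F = 0 <-> forall x, x \in real_spectrum M -> x ^+ 2 = a \/ x ^+ 2 = b).
Proof.
case: n M => [|n] M Msym F.
  split=> [_|]; first by apply/matrixP => -[].
  split=> _; last by apply/matrixP => -[].
  by move=> x; have /size0nil -> := symmetric_real_spectrum Msym.
pose p : {poly R} := ('X^2 - a%:P) * ('X^2 - b%:P).
have pM : horner_mx M p = F.
  by rewrite rmorphM !rmorphB rmorphXn /= horner_mx_X !horner_mx_C expr2.
have [_ p0] := symmetric_spectral_map p Msym; rewrite pM in p0.
have [trF _] := symmetric_spectral_map (p * p) Msym.
rewrite rmorphM /= pM in trF.
split.
  move=> tr0; apply/p0 => x xs; move: trF; rewrite [in RHS]tr0 => /eqP.
  rewrite psumr_eq0 => [/allP/(_ _ xs)|y _]; last by rewrite hornerM -expr2 sqr_ge0.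
  by rewrite hornerM mulf_eq0 orbb => /eqP.
rewrite p0; split=> h x /h.
  by rewrite !hornerE => /eqP; rewrite mulf_eq0 !subr_eq0 => /orP[]/eqP; auto.
by rewrite !hornerE => -[] ->; rewrite subrr ?mulr0 ?mul0r.
Qed.
End Spectrum.

(** * The moment inequality *)

Section EnergyInequality.
Variable R : rcfType.

Lemma sumr_ge0_eq0 (T : eqType) (s : seq T) (F : T -> R) :
  (forall x, x \in s -> 0 <= F x) -> \sum_(x <- s) F x = 0 ->
  forall x, x \in s -> F x = 0.
Proof.
move=> F0 /eqP; rewrite big_seq psumr_eq0 // => /allP sF x xs.
by have := sF x xs; rewrite xs => /eqP.
Qed.

(** Turns pointwise identities between quartics without cubic term into identities between
    moments. *)
Lemma sum_quartic (s : seq R) a b c e :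
  \sum_(y <- s) (a + b * y + c * y ^+ 2 + e * y ^+ 4)
  = a * (size s)%:R + b * (\sum_(y <- s) y) + c * (\sum_(y <- s) y ^+ 2)
    + e * (\sum_(y <- s) y ^+ 4).
Proof.
elim: s => [|y s IHs]; first by rewrite !big_nil !mulr0 !addr0.
by rewrite !big_cons IHs /= -natr1; ring.
Qed.

(** Unless all weights [1 - y ^+ 2] vanish, the hypothesis makes [t ^+ 2] the mean of [y ^+ 2] with
    these weights. *)
Lemma sum_le_two_moments (s : seq R) (t : R) :
  let S0 := (size s)%:R in
  let S1 := \sum_(y <- s) y in
  let S2 := \sum_(y <- s) y ^+ 2 in
  let S4 := \sum_(y <- s) y ^+ 4 in
  (forall y, y \in s -> 0 <= y <= 1) -> 0 <= t ->
  S2 - S4 = t ^+ 2 * (S0 - S2) ->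
  S1 <= (S2 + t * S0) / (1 + t) /\
  (S1 = (S2 + t * S0) / (1 + t) <-> forall y, y \in s -> y = 1 \/ y = t).
Proof.
move=> S0 S1 S2 S4 s01 t0 tE.
have t1 : 0 < 1 + t by lra.
have eq_of_two_values : (forall y, y \in s -> y = 1 \/ y = t) ->
    S1 = (S2 + t * S0) / (1 + t).
  move=> s2; apply: (mulIf (lt0r_neq0 t1)); rewrite mulfVK ?lt0r_neq0 //.
  (* This is [- (y - 1) (y - t)], which vanishes at both admissible values. *)
  have : \sum_(y <- s) (- t + (1 + t) * y + (- 1) * y ^+ 2 + 0 * y ^+ 4) = 0.
    by rewrite big1_seq // => y /andP[_ /s2] [] ->; ring.
  rewrite sum_quartic -/S0 -/S1 -/S2; lra.
(* At [t = 0] the factor [2 t (1 + t)] kills the information that the quartic gives on [S1].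
   Instead, [S2 = S4] already forces every [y] to be 0 or 1. *)
have [t00|tN0] := eqVneq t 0.
  have s2 y : y \in s -> y = 1 \/ y = t.
    have sum0 : \sum_(y <- s) (y ^+ 2 * (1 - y ^+ 2)) = 0.
      transitivity (S2 - S4); last by rewrite tE t00 expr0n mul0r.
      have -> : S2 - S4 = 0 * S0 + 0 * S1 + 1 * S2 + (-1) * S4 by ring.
      by rewrite -sum_quartic; apply: eq_bigr => z _; ring.
    move=> ys; have /andP[y0 y1] := s01 y ys.
    have /eqP : y ^+ 2 * (1 - y ^+ 2) = 0.
      apply: (sumr_ge0_eq0 _ sum0 ys) => z /s01 /andP[z0 z1].
      by rewrite mulr_ge0 ?sqr_ge0 // subr_ge0 expr_le1.
    rewrite mulf_eq0 sqrf_eq0 subr_eq0 t00 => /orP[/eqP|]; first by right.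
    by rewrite eq_sym sqrp_eq1 // => /eqP; left.
  by rewrite (eq_of_two_values s2).
have tp : 0 < t by rewrite lt0r tN0.
(* The quartic that vanishes at 1, doubly at t, and has no cubic term. *)
pose q y : R := (y - t) ^+ 2 * ((1 - y) * (y + 2 * t + 1)).
have q0 y : y \in s -> 0 <= q y.
  move=> /s01 /andP[y0 y1]; rewrite mulr_ge0 ?sqr_ge0 // mulr_ge0 //; lra.
(* The relation between the moments eliminates [S4]; what remains is a positive multiple of the gap
   in the inequality. *)
have qE : \sum_(y <- s) q y = 2 * t * (1 + t) * (S2 + t * S0 - (1 + t) * S1).
  have -> : \sum_(y <- s) q y = \sum_(y <- s) (t ^+ 2 * (2 * t + 1)
      + (- (2 * t * (t + 1) ^+ 2)) * y + (3 * t ^+ 2 + 2 * t + 1) * y ^+ 2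
      + (-1) * y ^+ 4) by apply: eq_bigr => y _; rewrite /q; ring.
  rewrite sum_quartic -/S0 -/S1 -/S2 -/S4; have -> : S4 = S2 - t ^+ 2 * (S0 - S2) by lra.
  by ring.
have c0 : 0 < 2 * t * (1 + t) by rewrite !mulr_gt0.
split.
  rewrite ler_pdivlMr // -subr_ge0 (mulrC S1) -(pmulr_rge0 _ c0) -qE.
  by rewrite big_seq; apply: sumr_ge0.
split=> // S1E y ys.
have sum0 : \sum_(y <- s) q y = 0.
  by rewrite qE S1E; field; apply: lt0r_neq0.
have /andP[y0 _] := s01 y ys.
have := sumr_ge0_eq0 q0 sum0 ys; rewrite /q => /eqP.
(* The remaining root [- (2 t + 1)] is negative, which [0 <= y] excludes. *)
rewrite mulf_eq0 sqrf_eq0 mulf_eq0 !subr_eq0 => /orP[/eqP|/orP[/eqP|/eqP]]; [by right|by left|lra].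
Qed.

(** Rescaling by [D] reduces the claim to [sum_le_two_moments]. The denominator is [D] times the sum
    of [(1 - y ^+ 2) ^+ 2], which explains when it vanishes. *)
Lemma energy_moment_bound (s : seq R) (D : R) :
  0 < D -> (forall x, x \in s -> `|x| <= D) ->
  let A := (\sum_(x <- s) x ^+ 4) / D ^+ 3 in
  let B := (\sum_(x <- s) x ^+ 2) / D in
  let C := D * (size s)%:R in
  let r := Num.sqrt (- A + B) * Num.sqrt (- B + C) in
  let bound := - ((B ^+ 2 + B * r - C * (A + r)) / (A - 2 * B + C)) in
  (A - 2 * B + C = 0 <-> forall x, x \in s -> x ^+ 2 = D ^+ 2) /\
  (A - 2 * B + C != 0 ->
   \sum_(x <- s) `|x| <= bound /\
   (\sum_(x <- s) `|x| = bound <->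
    exists a, forall x, x \in s -> x ^+ 2 = D ^+ 2 \/ x ^+ 2 = a)).
Proof.
move=> D0 sD A B C r bound; have DN0 := lt0r_neq0 D0.
pose ys := [seq `|x| / D | x <- s].
have ys01 y : y \in ys -> 0 <= y <= 1.
  move=> /mapP[x xs ->]; rewrite divr_ge0 ?normr_ge0 ?(ltW D0) //=.
  by rewrite ler_pdivrMr // mul1r sD.
(* Only even moments ignore the absolute value, which is why [M_2] and [M_4] enter the bound. *)
have ysX k : (~~ odd k) -> \sum_(y <- ys) y ^+ k = (\sum_(x <- s) x ^+ k) / D ^+ k.
  move=> kev; rewrite big_map mulr_suml; apply: eq_bigr => x _.
  by rewrite expr_div_n -normrX ger0_norm // exprn_even_ge0.
set S0 : R := (size ys)%:R; set S1 := \sum_(y <- ys) y.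
set S2 := \sum_(y <- ys) y ^+ 2; set S4 := \sum_(y <- ys) y ^+ 4.
have S0E : C = D * S0 by rewrite /S0 size_map.
have S1E : \sum_(x <- s) `|x| = D * S1.
  by rewrite /S1 big_map -mulr_suml mulrCA divff ?mulr1.
have S2E : B = D * S2 by rewrite /S2 ysX // /B; field.
have S4E : A = D * S4 by rewrite /S4 ysX // /A; field.
have sqE x : (x ^+ 2 == D ^+ 2) = (`|x| / D == 1).
  rewrite -[RHS]sqrp_eq1 ?divr_ge0 ?normr_ge0 ?(ltW D0) //.
  rewrite expr_div_n real_normK ?num_real // -[RHS](inj_eq (mulIf (expf_neq0 2 DN0))).
  by rewrite mul1r divfK ?expf_neq0.
have U0 y : y \in ys -> 0 <= 1 - y ^+ 2.
  by move=> /ys01 /andP[y0 y1]; rewrite subr_ge0 expr_le1.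
have UE : S0 - S2 = \sum_(y <- ys) (1 - y ^+ 2).
  have -> : S0 - S2 = 1 * S0 + 0 * S1 + (-1) * S2 + 0 * S4 by ring.
  by rewrite -sum_quartic; apply: eq_bigr => z _; ring.
have VE : S2 - S4 = \sum_(y <- ys) (y ^+ 2 * (1 - y ^+ 2)).
  have -> : S2 - S4 = 0 * S0 + 0 * S1 + 1 * S2 + (-1) * S4 by ring.
  by rewrite -sum_quartic; apply: eq_bigr => z _; ring.
have WE : S4 - 2 * S2 + S0 = \sum_(y <- ys) (1 - y ^+ 2) ^+ 2.
  have -> : S4 - 2 * S2 + S0 = 1 * S0 + 0 * S1 + (-2) * S2 + 1 * S4 by ring.
  by rewrite -sum_quartic; apply: eq_bigr => z _; ring.
have denE : A - 2 * B + C = D * (S4 - 2 * S2 + S0) by rewrite S0E S2E S4E; ring.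
have den0 : A - 2 * B + C = 0 <-> forall x, x \in s -> x ^+ 2 = D ^+ 2.
  rewrite denE WE; split=> [/eqP|sE].
    rewrite mulf_eq0 (negPf DN0) /= => /eqP sum0 x xs.
    have xys : `|x| / D \in ys by apply/mapP; exists x.
    have /eqP := sumr_ge0_eq0 (fun y _ => sqr_ge0 (1 - y ^+ 2)) sum0 xys.
    rewrite sqrf_eq0 subr_eq0 eq_sym => h.
    apply/eqP; rewrite sqE; move: h; rewrite sqrp_eq1 //.
    by have /andP[] := ys01 _ xys.
  rewrite big1_seq ?mulr0 // => y /andP[_ /mapP[x xs ->]].
  by have /eqP := sE x xs; rewrite sqE => /eqP ->; rewrite expr1n subrr expr0n.
split=> // denN0.
have UN0 : S0 - S2 != 0.
  apply: contra_neq denN0 => U00; apply/den0 => x xs; apply/eqP; rewrite sqE.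
  have xys : `|x| / D \in ys by apply/mapP; exists x.
  have sum0 : \sum_(y <- ys) (1 - y ^+ 2) = 0 by rewrite -UE.
  have /eqP := sumr_ge0_eq0 U0 sum0 xys.
  by rewrite subr_eq0 eq_sym sqrp_eq1 //; have /andP[] := ys01 _ xys.
have Up : 0 < S0 - S2 by rewrite lt0r UN0 UE big_seq sumr_ge0.
have V0 : 0 <= S2 - S4.
  by rewrite VE big_seq sumr_ge0 // => y yys; rewrite mulr_ge0 ?sqr_ge0 // U0.
pose t := Num.sqrt ((S2 - S4) / (S0 - S2)).
have t0 : 0 <= t := sqrtr_ge0 _.
have t2 : t ^+ 2 = (S2 - S4) / (S0 - S2) by rewrite sqr_sqrtr // divr_ge0 // ltW.
have tE : S2 - S4 = t ^+ 2 * (S0 - S2) by rewrite t2 divfK.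
(* Since [B - A = t ^+ 2 (C - B)], the product under the two roots is a perfect square. *)
have rE : r = t * (C - B).
  rewrite /r (_ : - A + B = (D * t * t) * (S0 - S2)); last first.
    by rewrite S4E S2E addrC -mulrBr tE; ring.
  rewrite (_ : - B + C = D * (S0 - S2)); last by rewrite S0E S2E; ring.
  rewrite -sqrtrM; last by rewrite !mulr_ge0 // ltW.
  rewrite [X in Num.sqrt X](_ : _ = (t * (C - B)) ^+ 2); last by rewrite S0E S2E; ring.
  rewrite sqrtr_sqr ger0_norm // S0E S2E -mulrBr !mulr_ge0 // ltW //.
have tN1 : 1 - t ^+ 2 != 0.
  apply: contra_neq denN0 => t21; rewrite denE.
  have -> : S4 - 2 * S2 + S0 = (1 - t ^+ 2) * (S0 - S2) by rewrite mulrBl -tE; ring.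
  by rewrite t21 mul0r mulr0.
have t1 : 0 < 1 + t by lra.
(* Once [A] is replaced by [B - t ^+ 2 (C - B)], numerator and denominator share the factor
   [(C - B) (1 - t)], nonzero by [UN0] and [tN1]. *)
have boundE : bound = D * ((S2 + t * S0) / (1 + t)).
  rewrite /bound rE S4E S2E S0E (_ : S4 = S2 - t ^+ 2 * (S0 - S2)); last by lra.
  have t1N0 : 1 - t != 0.
    by apply: contra_neq tN1 => t11; rewrite -{1}(expr1n _ 2) subr_sqr t11 mul0r.
  rewrite [X in _ / X](_ : _ = D * ((1 - t) * (1 + t) * (S0 - S2))); last by ring.
  by field; rewrite DN0 UN0 t1N0 lt0r_neq0.
have [le_bound eq_bound] := sum_le_two_moments ys01 t0 tE.
rewrite S1E boundE; split; first by rewrite ler_pM2l.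
have eqD : D * S1 = D * ((S2 + t * S0) / (1 + t)) <-> S1 = (S2 + t * S0) / (1 + t).
  by split=> [|->] //; apply: mulfI.
rewrite eqD eq_bound; split=> [h|[a sa] y yys].
  exists ((t * D) ^+ 2) => x xs.
  have /h [] : `|x| / D \in ys by apply/mapP; exists x.
    by move=> /eqP; rewrite -sqE => /eqP; left.
  by move=> <-; right; rewrite mulfVK // real_normK ?num_real.
have ys2 z : z \in ys -> z = 1 \/ z ^+ 2 = a / D ^+ 2.
  move=> /mapP[x xs ->]; have [/eqP|<-] := sa x xs.
    by rewrite sqE => /eqP; left.
  by right; rewrite expr_div_n real_normK ?num_real.
(* The identity holds term by term, both sides being 0 at [y = 1]. Comparison with [tE] forces
   [a = (t D) ^+ 2]. *)
have : S2 - S4 = (a / D ^+ 2) * (S0 - S2).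
  rewrite VE UE mulr_sumr; apply: eq_big_seq => z /ys2 [->|->] //.
  by rewrite expr1n subrr !mulr0.
rewrite tE => /(mulIf UN0) t2a.
have [->|] := ys2 y yys; first by left.
rewrite -t2a => /eqP; rewrite eqrXn2 //; first by move=> /eqP; right.
by have /andP[] := ys01 y yys.
Qed.
End EnergyInequality.

(** * Common neighbours and two-step walks *)

Section CommonNeighbours.
Variable G : sgraph.
Implicit Types (x y z w : G).

(** The number of two-step walks from [x] to [y], that is, an entry of the squared adjacency matrix;
    for [x = y] it is the degree. *)
Definition codegree x y : nat := #|neighbours x :&: neighbours y|.

Lemma codegree_sym x y : codegree x y = codegree y x.
Proof. by rewrite /codegree setIC. Qed.

Lemma codegree_id x : codegree x x = degree x.
Proof. by rewrite /codegree setIid. Qed.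

Lemma codegreeE x y : codegree x y = (\sum_w adj x w * adj w y)%N.
Proof.
rewrite /codegree -sum1_card big_mkcond; apply: eq_bigr => w _.
by rewrite !inE (adj_sym y w); case: (adj x w); case: (adj w y).
Qed.

Lemma degreeE x : degree x = (\sum_w adj x w)%N.
Proof.
rewrite /degree -sum1_card big_mkcond; apply: eq_bigr => w _.
by rewrite inE; case: (adj x w).
Qed.

Lemma codegree_gt0P x y :
  reflect (exists2 w, adj x w & adj w y) (0 < codegree x y)%N.
Proof.
apply: (iffP card_gt0P) => [[w]|[w xw wy]].
  by rewrite !inE => /andP[xw yw]; exists w; rewrite // adj_sym.
by exists w; rewrite !inE xw adj_sym.
Qed.

Lemma sum_codegree x : (\sum_y codegree x y = \sum_(w | adj x w) degree w)%N.
Proof.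
under eq_bigr do rewrite codegreeE.
rewrite exchange_big /= [RHS]big_mkcond; apply: eq_bigr => w _.
rewrite -big_distrr -degreeE /=; case: (adj x w); by rewrite ?mul1n ?mul0n.
Qed.

Lemma sum_adj_const x c : (\sum_(w | adj x w) c = degree x * c)%N.
Proof.
by rewrite sum_nat_const; congr (_ * _)%N; apply: eq_card => w; rewrite [RHS]inE.
Qed.

Lemma degree_le_max x : (degree x <= max_degree G)%N.
Proof. exact: leq_bigmax. Qed.

Lemma sum_codegree_le x :
  (\sum_y codegree x y <= degree x * max_degree G)%N.
Proof.
rewrite sum_codegree -sum_adj_const; apply: leq_sum => w _; exact: degree_le_max.
Qed.

Lemma max_degree_regular k x : (forall y, degree y = k) -> max_degree G = k.
Proof.
move=> degk; apply/eqP; rewrite eqn_leq -{2}(degk x) degree_le_max andbT.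
by apply/bigmax_leqP => y _; rewrite degk.
Qed.

Lemma sum_codegree_regular k x :
  (forall y, degree y = k) -> (\sum_y codegree x y = k * k)%N.
Proof.
move=> degk; rewrite sum_codegree (eq_bigr (fun=> k)) => [|w _]; last exact: degk.
by rewrite sum_adj_const degk.
Qed.

(** Equality case of the chain [sum <= degree x * Delta <= Delta * Delta]: both estimates must be
    tight. *)
Lemma sum_codegree_max x :
  (\sum_y codegree x y = max_degree G * max_degree G)%N ->
  degree x = max_degree G /\ forall w, adj x w -> degree w = max_degree G.
Proof.
move=> sumE; set D := max_degree G in sumE *.
have dx : degree x = D.
  have := sum_codegree_le x; rewrite sumE -/D.
  have := degree_le_max x; rewrite -/D; nia.
split=> // w xw; apply/eqP; rewrite eqn_leq degree_le_max leqNgt; apply/negP => wD.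
have : (\sum_(w | adj x w) degree w < \sum_(w | adj x w) D)%N.
  rewrite [ltnRHS](bigD1 w) //= (bigD1 w) //= -addSn leq_add //.
  by apply: leq_sum => u _; apply: degree_le_max.
by rewrite -sum_codegree sumE sum_adj_const dx ltnn.
Qed.

Hypothesis Gconn : connected G.

(** Induction along paths, the form in which connectedness is used. *)
Lemma connected_closed (Q : G -> Prop) x :
  Q x -> (forall y z, adj y z -> Q y -> Q z) -> forall y, Q y.
Proof.
move=> Qx Qadj y; have /connectP[p pth ->] := Gconn x y.
by elim: p x Qx pth => //= z p IHp x Qx /andP[/Qadj/(_ Qx)/IHp h /h].
Qed.

Lemma connected_degree_gt0 x : (1 < #|G|)%N -> (0 < degree x)%N.
Proof.
move=> G2; rewrite lt0n; apply/negP => /eqP deg0.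
have noadj y : adj x y = false.
  by move/eqP: deg0; rewrite /degree cards_eq0 => /eqP/setP/(_ y); rewrite !inE.
have all_x : forall y, y = x.
  by apply: (connected_closed (x := x)) => // y z yz yx; rewrite yx noadj in yz.
have : (#|G| <= 1)%N by apply/card_le1_eqP => y z _ _; rewrite (all_x y) (all_x z).
by rewrite leqNgt G2.
Qed.

(** Otherwise every vertex has at most one neighbour, and a single edge is already a whole
    component. *)
Lemma connected_codegree_gt0 :
  (2 < #|G|)%N -> exists x y, x != y /\ (0 < codegree x y)%N.
Proof.
move=> G3; have G2 : (1 < #|G|)%N := ltnW G3.
have [/existsP[x /existsP[y /andP[]]]|no] :=
  boolP [exists x, exists y, (x != y) && (0 < codegree x y)%N].
  by exists x, y.
have eq_adj w x y : adj w x -> adj w y -> x = y.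
  move=> wx wy; apply/eqP; apply: contraNT no => xy.
  apply/existsP; exists x; apply/existsP; exists y; rewrite xy.
  by apply/codegree_gt0P; exists w; rewrite // adj_sym.
have /card_gt0P[x _] : (0 < #|G|)%N by rewrite ltnW.
have /card_gt0P[y] := connected_degree_gt0 x G2; rewrite inE => xy.
have all2 : forall z, z \in [set x; y].
  apply: (connected_closed (x := x)); first by rewrite !inE eqxx.
  move=> u v uv; rewrite !inE => /orP[]/eqP uE; rewrite uE in uv.
    by rewrite (eq_adj _ _ _ uv xy) eqxx orbT.
  by rewrite adj_sym in xy; rewrite (eq_adj _ _ _ uv xy) eqxx.
have : (#|G| <= #|[set x; y]|)%N by apply/subset_leq_card/subsetP => z _; apply: all2.
by rewrite cards2 => /(leq_trans G3); case: (x != y).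
Qed.


Lemma card2_degree x : #|G| = 2%N -> degree x = 1%N.
Proof.
move=> G2; apply/eqP; rewrite eqn_leq connected_degree_gt0 ?G2 // andbT.
have : (degree x <= #|[set~ x]|)%N.
  by apply/subset_leq_card/subsetP => y; rewrite !inE; apply: contraTneq => ->; rewrite adj_irrefl.
by rewrite cardsC1 G2.
Qed.

Lemma card2_codegree x y : #|G| = 2%N -> x != y -> codegree x y = 0%N.
Proof.
move=> G2 xy; apply/eqP; rewrite -leqn0 leqNgt; apply/negP => /codegree_gt0P[w xw wy].
have : (#|[set x; y; w]| <= #|G|)%N by apply: max_card.
rewrite G2 -setUA cardsU1 !inE cards2 (negPf xy) /=.
have -> : (x == w) = false by apply: contraTF xw => /eqP ->; rewrite adj_irrefl.
by have -> : (y == w) = false by apply: contraTF wy => /eqP ->; rewrite adj_irrefl.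
Qed.

(** The classes of [connect two_steps] are those of vertices joined by walks of even length: all of
    [G], or the two sides of a bipartition when [G] is connected and bipartite. *)
Definition two_steps : rel G := [rel x y | (0 < codegree x y)%N].

Lemma two_steps_cover x y :
  connect two_steps x y \/ exists2 w, connect two_steps x w & adj w y.
Proof.
move: y; apply: (connected_closed (x := x)); first by left; apply: connect0.
move=> y z yz [xy|[w xw wy]]; first by right; exists y.
by left; apply: connect_trans xw _; apply/connect1/codegree_gt0P; exists y.
Qed.

(* A bipartition into points (P) and blocks that makes G the incidence graph of
   a symmetric design. *)
Definition design_bipartition (P : {set G}) (k lam : nat) : Prop :=
  [/\ #|P| = #|~: P|, forall x y, adj x y -> (x \in P) != (y \in P),
      forall x, x \notin P -> degree x = k
    & forall x y, x \in P -> y \in P -> x != y -> codegree x y = lam].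

(** Both sums count the edges, each having one end in [P] and one outside. *)
Lemma sum_degree_bipartite (P : {set G}) :
  (forall x y, adj x y -> (x \in P) != (y \in P)) ->
  (\sum_(x in P) degree x = \sum_(x in ~: P) degree x)%N.
Proof.
move=> cross.
rewrite (eq_bigr (fun y => \sum_(z in ~: P) adj y z)%N).
  rewrite exchange_big /=; apply: eq_bigr => z; rewrite inE => /negPf zP.
  rewrite degreeE big_mkcond; apply: eq_bigr => y _; rewrite adj_sym.
  case: (boolP (adj z y)) => [/cross|]; last by case: ifP.
  by rewrite zP; case: (y \in P).
move=> y yP; rewrite degreeE [RHS]big_mkcond; apply: eq_bigr => z _ /=.
rewrite inE; case: (boolP (adj y z)) => [/cross|]; last by case: ifP.
by rewrite yP; case: (z \in P).
Qed.

(** The alternative is whether the even class of [x] is everything. If not, it is one side of a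
    bipartition, and regularity with [0 < k] makes the two sides equal in size. *)
Lemma regular_two_steps_classification k lam x :
  (forall y, degree y = k) -> (0 < k)%N ->
  (forall y z, connect two_steps x y -> connect two_steps x z -> y != z ->
    codegree y z = lam) ->
  strongly_regular G lam lam \/ exists P, design_bipartition P k lam.
Proof.
move=> degk k0 codeg.
have [/forallP one_class|two_classes] := boolP [forall y, connect two_steps x y].
  left; split; first by exists k.
    by move=> y z yz; apply: codeg => //; apply: contraTneq yz => ->; rewrite adj_irrefl.
  by move=> y z yz _; apply: codeg.
right; exists [set y | connect two_steps x y].
pose P y := connect two_steps x y; pose Q y := exists2 w, P w & adj w y.
have PQ y z : adj y z -> P y -> Q z by move=> yz Py; exists y.
have QP y z : adj y z -> Q y -> P z.
  move=> yz [w Pw wy]; apply: connect_trans Pw _.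
  by apply/connect1/codegree_gt0P; exists y.
(* Edges exchange [P] and [Q], so one vertex in both would put every vertex in both, contradicting
   [two_classes]. *)
have PNQ y : P y -> ~ Q y.
  move=> Py Qy; case/negP: two_classes; apply/forallP => z.
  suff [] : P z /\ Q z by [].
  move: z; apply: (connected_closed (x := y)) => // u v uv [Pu Qu].
  by split; [apply: QP uv Qu|apply: PQ uv Pu].
have cross y z : adj y z -> P y = ~~ P z.
  move=> yz; apply/idP/idP => [Py|]; first by apply/negP => /PNQ; apply; apply: PQ yz Py.
  have [Pz|Qz _] := two_steps_cover x z; first by rewrite /P Pz.
  by apply: QP Qz; rewrite adj_sym.
split.
- have sumk (A : {set G}) : (\sum_(y in A) degree y = #|A| * k)%N.
    by rewrite -sum_nat_const; apply: eq_bigr => y _; apply: degk.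
  apply/eqP; rewrite -(eqn_pmul2r k0) -!sumk; apply/eqP/sum_degree_bipartite.
  move=> y z /cross yz; rewrite !inE; move: yz; rewrite /P => ->; by case: connect.
- by move=> y z yz; rewrite !inE -!/(P _) (cross y z) //; case: (P z).
- by move=> y _; apply: degk.
by move=> y z; rewrite !inE; apply: codeg.
Qed.

Lemma bipartite_codegree0 (P : {set G}) x y :
  (forall u v, adj u v -> (u \in P) != (v \in P)) ->
  (x \in P) != (y \in P) -> codegree x y = 0%N.
Proof.
move=> cross xy; apply/eqP; rewrite -leqn0 leqNgt.
apply/negP => /codegree_gt0P[w /cross xw /cross wy]; move: xw wy xy.
by case: (x \in P); case: (w \in P); case: (y \in P).
Qed.

(** Counts the two-step walks from [x] first by their middle block, then by their final point, with
    [x] itself split off. *)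
Lemma design_point_count P k lam x :
  design_bipartition P k lam -> x \in P ->
  (degree x * k = degree x + #|P|.-1 * lam)%N.
Proof.
move=> [_ cross degk codeg] xP; transitivity (\sum_y codegree x y)%N.
  rewrite sum_codegree -sum_adj_const; apply: eq_bigr => w /cross.
  by rewrite xP => wP; rewrite degk //; move: wP; case: (w \in P).
rewrite (bigID (mem P)) /= [X in (_ + X)%N]big1 => [|y yP]; last first.
  by apply: (bipartite_codegree0 cross); rewrite xP.
rewrite addn0 (bigD1 x) //= codegree_id; congr (_ + _)%N.
rewrite (eq_bigr (fun=> lam)) => [|y /andP[yP yx]]; last by rewrite codeg // eq_sym.
rewrite sum_nat_const; congr (_ * _)%N.
rewrite (cardsD1 x) xP add1n /=; apply: eq_card => y; rewrite [LHS]unfold_in !inE.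
by rewrite andbC.
Qed.

(** Only block degrees are prescribed. For [1 < k] the point count makes all point degrees equal,
    and counting edges between sides of equal size then gives [k]. *)
Lemma design_bipartition_regular P k lam :
  (2 < #|G|)%N -> design_bipartition P k lam -> forall x, degree x = k.
Proof.
move=> G3 [cardP cross degk codeg].
have G2 : (1 < #|G|)%N := ltnW G3.
have cardG : #|G| = (#|P| + #|P|)%N by rewrite {2}cardP cardsC.
have [B BP] : exists B, B \notin P.
  have : (0 < #|~: P|)%N by rewrite -cardP; lia.
  by case/card_gt0P => B; rewrite inE; exists B.
have k0 : (0 < k)%N by rewrite -(degk B BP) connected_degree_gt0.
have crossN y z : y \notin P -> adj y z -> z \in P.
  by move=> /negPf yP /cross; rewrite yP; case: (z \in P).
have crossP y z : y \in P -> adj y z -> z \notin P.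
  by move=> yP /cross; rewrite yP; case: (z \in P).
have count := design_point_count (And4 cardP cross degk codeg).
have [k1|k1] := leqP k 1.
(* Blocks have one point each, so a point and its blocks exhaust G. *)
  have kE : k = 1%N by lia.
  have /card_gt0P[x] : (0 < degree B)%N by rewrite connected_degree_gt0.
  rewrite inE => Bx; have xP := crossN _ _ BP Bx.
  have star : forall y, y = x \/ adj x y.
    apply: (connected_closed (x := x)); first by left.
    move=> y z yz [yE|xy]; first by right; rewrite -yE.
    left; have : (degree y <= 1)%N by rewrite degk ?kE // (crossP _ _ xP xy).
    by move=> /card_le1_eqP; apply; rewrite inE // adj_sym.
  have : (#|P| <= 1)%N.
    apply/card_le1_eqP => y z yP zP.
    have aux u : u \in P -> u = x.
      by move=> uP; have [//|/(crossP _ _ xP)] := star u; rewrite uP.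
    by rewrite (aux y yP) (aux z zP).
  lia.
have [r degr] : exists r, forall x, x \in P -> degree x = r.
  have /card_gt0P[x xP] : (0 < #|P|)%N by lia.
  by exists (degree x) => y yP; have := count x xP; have := count y yP; nia.
suff rk : r = k by move=> x; have [/degr ->|/degk] := boolP (x \in P).
have := sum_degree_bipartite cross.
have -> : (\sum_(x in P) degree x = #|P| * r)%N.
  by rewrite -sum_nat_const; apply: eq_bigr.
have -> : (\sum_(x in ~: P) degree x = #|~: P| * k)%N.
  by rewrite -sum_nat_const; apply: eq_bigr => x; rewrite inE; apply: degk.
by rewrite -cardP => /eqP; rewrite eqn_pmul2l => [/eqP //|]; lia.
Qed.

(** Both sides count closed walks [z, w, y, u, z]: grouped by [y] on the left, by [w] and [u] on the
    right. *)
Lemma sum_codegree_square z :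
  (\sum_y codegree z y * codegree z y
   = \sum_(w | adj z w) \sum_(u | adj z u) codegree w u)%N.
Proof.
under eq_bigr => y _ do rewrite {1}codegreeE big_distrl /=.
rewrite exchange_big /= [RHS]big_mkcond; apply: eq_bigr => w _ /=.
case: (adj z w); last by rewrite big1.
transitivity (\sum_y \sum_u adj z u * (adj w y * adj y u))%N.
  apply: eq_bigr => y _; rewrite mul1n codegreeE big_distrr /=.
  by apply: eq_bigr => u _; rewrite (adj_sym u y); lia.
rewrite exchange_big /= [RHS]big_mkcond; apply: eq_bigr => u _ /=.
by rewrite codegreeE -big_distrr /=; case: (adj z u); rewrite ?mul1n.
Qed.

(* Any two blocks of a symmetric design meet in lam points: the variance of the
   block intersection numbers around lam vanishes. *)
Lemma design_block_codegree P k lam x z :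
  design_bipartition P k lam -> (forall y, degree y = k) ->
  x \notin P -> z \notin P -> z != x -> codegree z x = lam.
Proof.
move=> desP degk xP zP zx; have [cardP cross _ codeg] := desP.
pose a y : int := (codegree z y)%:R; pose l : int := lam%:R; pose K : int := k%:R.
have G2 : (1 < #|G|)%N.
  by have := max_card (mem [set z; x]); rewrite cards2 zx.
have k0 : (0 < k)%N by rewrite -(degk z) connected_degree_gt0.
have predk : k.-1%:R = K - 1 :> int by rewrite -subn1 natrB.
have [p pP] : exists p, p \in P.
  by apply/card_gt0P; rewrite cardP; apply/card_gt0P; exists z; rewrite inE.
have count : K * K = K + (#|P|%:R - 1) * l.
  have := design_point_count desP pP; rewrite degk => /(congr1 (fun n => n%:R : int)).
  rewrite natrM natrD natrM => ->; congr (_ + _ * _); rewrite -subn1 natrB //.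
  by apply/card_gt0P; exists p.
have a0 y : y \in P -> a y = 0.
  by move=> yP; rewrite /a (bipartite_codegree0 cross) // yP (negPf zP).
have sum_block (f : G -> int) : (forall y, y \in P -> f y = 0) ->
    \sum_y f y = \sum_(y in ~: P) f y.
  move=> f0; rewrite (bigID (mem P)) /= big1 // add0r.
  by apply: eq_bigl => y; rewrite inE.
have S1 : \sum_(y in ~: P) a y = K * K.
  by rewrite -sum_block // -natr_sum (sum_codegree_regular z degk) natrM.
(* The neighbours of the block [z] are points, whose codegrees are known: [k] on the diagonal and
   [lam] off it. *)
have S2 : \sum_(y in ~: P) a y ^+ 2 = K * (K + (K - 1) * l).
  rewrite -(sum_block (fun y => a y ^+ 2)) => [|y /a0 ->]; last by rewrite expr0n.
  under eq_bigr do rewrite /a expr2 -natrM.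
  rewrite -natr_sum sum_codegree_square.
  have zP' w : adj z w -> w \in P by move=> /cross; rewrite (negPf zP); case: (w \in P).
  rewrite (eq_bigr (fun=> k + k.-1 * lam)%N) => [|w zw].
    rewrite sum_adj_const degk natrM natrD natrM.
    by rewrite predk.
  rewrite (bigD1 w) //= codegree_id degk; congr (_ + _)%N.
  rewrite (eq_bigr (fun=> lam)) => [|u /andP[zu uw]].
    rewrite sum_nat_const; congr (_ * _)%N; rewrite -(degk z) /degree.
    rewrite (cardsD1 w (neighbours z)) inE zw add1n /=; apply: eq_card => u.
    by rewrite [LHS]unfold_in !inE andbC.
  by rewrite codeg ?zP' // eq_sym.
have S0 : \sum_(y in ~: P) l ^+ 2 = (#|P|)%:R * l ^+ 2.
  by rewrite sumr_const cardP mulr_natl.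
have : \sum_(y in ~: P | y != z) (a y - l) ^+ 2 = 0.
  have azz : a z = K by rewrite /a codegree_id degk.
  (* The block [z] meets itself in [k] points, so its own term is [(K - l) ^+ 2] and uses up the
     whole sum. *)
  have : \sum_(y in ~: P) (a y - l) ^+ 2 = (K - l) ^+ 2.
    have -> : \sum_(y in ~: P) (a y - l) ^+ 2 = \sum_(y in ~: P) a y ^+ 2
        + \sum_(y in ~: P) l ^+ 2 - \sum_(y in ~: P) (2 * l) * a y.
      by rewrite -big_split -sumrB; apply: eq_bigr => y _ /=; ring.
    rewrite S2 S0 -mulr_sumr S1.
    have -> : #|P|%:R * l ^+ 2 = l * ((#|P|%:R - 1) * l) + l ^+ 2 by ring.
    have -> : (#|P|%:R - 1) * l = K * K - K by rewrite count; ring.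
    by ring.
  by rewrite (bigD1 z) ?inE //= azz => /(canRL (addKr _)) ->; rewrite addNr.
move=> /eqP; rewrite psumr_eq0 => [/allP/(_ x (mem_index_enum _))|y _]; last exact: sqr_ge0.
rewrite inE xP eq_sym zx /= sqrf_eq0 subr_eq0 /a /l eqr_nat => /eqP //.
Qed.

End CommonNeighbours.

(** * Symmetric designs as bipartitions *)

Section Isomorphism.
Variables (G H : sgraph) (f : G -> H).
Hypotheses (f_bij : bijective f) (f_adj : forall x y, adj (f x) (f y) = adj x y).

Lemma iso_codegree x y : codegree (f x) (f y) = codegree x y.
Proof.
have f_inj := bij_inj f_bij; rewrite /codegree -[RHS](card_imset _ f_inj).
apply: eq_card => z; have [g gK fK] := f_bij.
by rewrite -(fK z) mem_imset // !inE !f_adj.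
Qed.

Lemma iso_design_bipartition P k lam :
  design_bipartition P k lam -> design_bipartition (f @^-1: P) k lam.
Proof.
have f_inj := bij_inj f_bij.
have card_preim (A : {set H}) : #|f @^-1: A| = #|A|.
  rewrite -(card_imset _ f_inj); apply: eq_card => z; have [g gK fK] := f_bij.
  by rewrite -(fK z) mem_imset // inE.
move=> [cardP cross degk codeg]; split.
- by rewrite -preimsetC !card_preim.
- by move=> x y; rewrite -f_adj !inE; apply: cross.
- by move=> x; rewrite inE -codegree_id -iso_codegree codegree_id; apply: degk.
by move=> x y; rewrite !inE -iso_codegree -(inj_eq f_inj); apply: codeg.
Qed.
End Isomorphism.

Lemma incidence_design_bipartition (X F : finType) (blk : F -> {set X}) v k lam :
  symmetric_design blk v k lam ->
  exists P : {set incidence_graph blk}, design_bipartition P k lam.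
Proof.
move=> [cardX cardF blk_k blk_lam]; pose I := incidence_graph blk.
have inr_inj : injective (inr : X -> I) by move=> x y [].
have inl_inj : injective (inl : F -> I) by move=> x y [].
exists [set (inr x : I) | x in X]; split.
- rewrite card_imset // cardX -cardF -(card_imset _ inl_inj); apply: eq_card.
  move=> [B|x]; rewrite inE.
    rewrite mem_imset //; apply/esym/imsetP => -[] //.
  by rewrite mem_imset //; apply/negbTE/imsetP => -[].
- by move=> [B|x] [B'|y] //= _; rewrite mem_imset // inE; case: imsetP => // -[].
- move=> [B _|x]; last by rewrite mem_imset ?inE.
  rewrite /degree -(blk_k B) -(card_imset _ inr_inj); apply: eq_card.
  by move=> [B'|x]; rewrite inE ?mem_imset //=; apply/esym/imsetP => -[].
move=> _ _ /imsetP[x _ ->] /imsetP[y _ ->]; rewrite (inj_eq inr_inj) => xy.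
rewrite /codegree -(blk_lam x y xy) -(card_imset _ inl_inj); apply: eq_card.
by move=> [B|z]; rewrite !inE ?mem_imset ?inE //=; apply/esym/imsetP => -[].
Qed.

(** Vertices of [P] serve as points, the others as blocks, and each block consists of its
    neighbours; [g] forgets the side. *)
Lemma design_bipartition_incidence (G : sgraph) (P : {set G}) k lam :
  design_bipartition P k lam -> is_symmetric_design_graph G.
Proof.
move=> [cardP cross degk codeg].
pose X : finType := {x : G | x \in P}; pose F : finType := {x : G | x \notin P}.
pose blk (B : F) := [set x : X | adj (val B) (val x)].
pose g (a : incidence_graph blk) : G :=
  match a with inl B => val B | inr x => val x end.
have cardX : #|X| = #|P| by rewrite card_sig; apply: eq_card => x; rewrite !inE.
have cardF : #|F| = #|P|.
  by rewrite card_sig cardP; apply: eq_card => x; rewrite !inE.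
have g_inj : injective g.
  move=> [[B BP]|[x xP]] [[B' BP']|[y yP]] /= e.
  - by congr inl; apply: val_inj.
  - by case/negP: (BP); rewrite e.
  - by case/negP: (BP'); rewrite -e.
  - by congr inr; apply: val_inj.
have g_bij : bijective g.
  by apply: inj_card_bij => //; rewrite card_sum cardX cardF {2}cardP cardsC.
have g_adj a b : adj a b = adj (g a) (g b).
  have same x y : (x \in P) = (y \in P) -> adj x y = false.
    by move=> xy; apply/negbTE/negP => /cross; rewrite xy eqxx.
  case: a b => [[B BP]|[x xP]] [[B' BP']|[y yP]] //=.
  - by rewrite same // (negPf BP) (negPf BP').
  - by rewrite inE.
  - by rewrite inE adj_sym.
  - by rewrite same // xP yP.
exists X, F, blk, #|P|, k, lam; split; last first.
  have [f gK fK] := g_bij; exists f; first by exists g.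
  by move=> x y; rewrite g_adj !fK.
have cardN (Y : {set G}) (S : finType) (h : S -> G) (A : {set S}) :
  injective h -> h @: A = Y -> #|A| = #|Y| by move=> h_inj <-; rewrite card_imset.
split=> // [[B BP]|[x xP] [y yP] xy].
  rewrite -(degk B BP); apply: (cardN _ X val _ val_inj).
  apply/setP => z; rewrite inE; apply/imsetP/idP => [[[w wP]]|Bz].
    by rewrite inE => Bw ->.
  have zP : z \in P by move: (cross B z Bz); rewrite (negPf BP); case: (z \in P).
  by exists (exist _ z zP); rewrite ?inE.
rewrite -(codeg x y xP yP xy); apply: (cardN _ F val _ val_inj).
apply/setP => z; rewrite !inE; apply/imsetP/andP => [[[w wP]]|[xz yz]].
  by rewrite !inE /= => /andP[xw yw] ->; rewrite !(adj_sym _ w).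
have zP : z \notin P by move: (cross x z xz); rewrite xP; case: (z \in P).
by exists (exist _ z zP); rewrite ?inE //= !(adj_sym z) xz.
Qed.

(** * The spectrum of the adjacency matrix *)

Section AdjacencySpectrum.
Variables (R : rcfType) (G : sgraph).
Implicit Types x y z : G.
Local Notation M := (adjacency_mx R G).
Local Notation D := ((max_degree G)%:R : R).
Local Notation codeg x y := ((codegree x y)%:R : R).

Lemma sum_ord_vertex (F : G -> R) : \sum_(i < #|G|) F (enum_val i) = \sum_x F x.
Proof. by rewrite [RHS](big_enum_val (A := G)). Qed.

Lemma adjacency_mx_sym : M^T = M.
Proof. by apply/matrixP => i j; rewrite !mxE adj_sym. Qed.

Lemma adjacency_mx_square i j :
  (M *m M) i j = codeg (enum_val i) (enum_val j).
Proof.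
rewrite mxE codegreeE natr_sum -sum_ord_vertex; apply: eq_bigr => k _.
by rewrite !mxE natrM.
Qed.

(** The first factor is kept as an operator and the second as a family of columns, so that the
    columns of [M ^+ 2 - b] appear as eigenvectors of [M ^+ 2]. *)
Lemma adjacency_mx_two_squares (a b : R) :
  (M *m M - a%:M) *m (M *m M - b%:M) = 0 <->
  forall x z, \sum_y codeg x y * (codeg y z - b * (y == z)%:R)
    = a * (codeg x z - b * (x == z)%:R).
Proof.
have entry c i j : (M *m M - c%:M) i j
    = codeg (enum_val i) (enum_val j) - c * (enum_val i == enum_val j)%:R.
  by rewrite !mxE -adjacency_mx_square !mxE (inj_eq enum_val_inj) mulr_natr.
have entry2 i j : ((M *m M - a%:M) *m (M *m M - b%:M)) i j =
    \sum_y codeg (enum_val i) y * (codeg y (enum_val j) - b * (y == enum_val j)%:R)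
    - a * (codeg (enum_val i) (enum_val j) - b * (enum_val i == enum_val j)%:R).
  rewrite mxE; under eq_bigr do rewrite !entry.
  rewrite (sum_ord_vertex (fun y => (codeg (enum_val i) y - a * (enum_val i == y)%:R)
     * (codeg y (enum_val j) - b * (y == enum_val j)%:R))).
  under eq_bigr do rewrite mulrBl.
  rewrite sumrB; congr (_ - _).
  rewrite (bigD1 (enum_val i)) //= eqxx mulr1 big1 ?addr0 // => y.
  by rewrite eq_sym => /negPf ->; rewrite mulr0 mul0r.
split=> [F0 x z | h].
  have := entry2 (enum_rank x) (enum_rank z).
  by rewrite F0 !enum_rankK mxE => /esym/subr0_eq.
by apply/matrixP => i j; rewrite entry2 h subrr mxE.
Qed.

Lemma adjacency_mx_square_scalar (a : R) :
  M *m M = a%:M <-> forall x y, codeg x y = a * (x == y)%:R.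
Proof.
split=> [MM x y | h].
  rewrite -(enum_rankK x) -(enum_rankK y) -adjacency_mx_square MM mxE.
  by rewrite (inj_eq enum_val_inj) mulr_natr.
by apply/matrixP => i j; rewrite adjacency_mx_square h mxE (inj_eq enum_val_inj) mulr_natr.
Qed.

Lemma sum_adj_degree x : \sum_y (adj x y)%:R = (degree x)%:R :> R.
Proof. by rewrite degreeE natr_sum. Qed.

(* Both bounds come from \sum_(x ~ y) (v x -+ v y) ^+ 2 >= 0. *)
Lemma adjacency_spectral_radius l : l \in eigenvalues R G -> `|l| <= D.
Proof.
move=> ls; have charN0 : char_poly M != 0 := monic_neq0 (char_poly_monic M).
have : root (char_poly M) l.
  move: ls; rewrite /eigenvalues => /flatten_mapP[x xr].
  rewrite mem_nseq => /andP[_ /eqP ->].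
  by have := roots_on_rootsR charN0 x; rewrite in_itv /= xr => ->.
rewrite -eigenvalue_root_char => /eigenvalueP[u uM uN0].
pose v x := u 0 (enum_rank x).
have vM x : \sum_y (adj x y)%:R * v y = l * v x.
  have := congr1 (fun A : 'rV_#|G| => A 0 (enum_rank x)) uM; rewrite !mxE -/(v x) => <-.
  rewrite -sum_ord_vertex; apply: eq_bigr => i _.
  by rewrite !mxE /v enum_valK enum_rankK adj_sym mulrC.
have v2 : 0 < \sum_x v x ^+ 2.
  rewrite lt0r sumr_ge0 ?andbT => [|x _]; last exact: sqr_ge0.
  apply: contra uN0; rewrite psumr_eq0 => [/allP v0|x _]; last exact: sqr_ge0.
  apply/eqP/matrixP => i j; rewrite ord1 mxE.
  by have := v0 (enum_val j) (mem_index_enum _); rewrite sqrf_eq0 /v enum_valK => /eqP.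
(* The squares contribute the weighted degree sum twice; the eigenvector equation evaluates the
   cross terms. *)
have quad (e : R) : e ^+ 2 = 1 ->
    0 <= 2 * \sum_x ((degree x)%:R * v x ^+ 2) + 2 * e * (l * \sum_x v x ^+ 2).
  move=> e2; rewrite [X in _ <= X](_ : _ =
      \sum_x \sum_y (adj x y)%:R * (v x + e * v y) ^+ 2).
    by apply: sumr_ge0 => x _; apply: sumr_ge0 => y _; rewrite mulr_ge0 ?ler0n ?sqr_ge0.
  have -> : \sum_x \sum_y (adj x y)%:R * (v x + e * v y) ^+ 2 =
      \sum_x \sum_y (adj x y)%:R * v x ^+ 2 + \sum_x \sum_y (adj x y)%:R * v y ^+ 2
      + \sum_x \sum_y 2 * e * (v x * ((adj x y)%:R * v y)).
    rewrite -!big_split; apply: eq_bigr => x _; rewrite -!big_split.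
    by apply: eq_bigr => y _ /=; ring: e2.
  have dE : \sum_x \sum_y (adj x y)%:R * v x ^+ 2 = \sum_x ((degree x)%:R * v x ^+ 2).
    by apply: eq_bigr => x _; rewrite -mulr_suml sum_adj_degree.
  rewrite dE exchange_big /= (_ : \sum_y \sum_x (adj x y)%:R * v y ^+ 2
      = \sum_x ((degree x)%:R * v x ^+ 2)); last first.
    by rewrite -dE; apply: eq_bigr => x _; apply: eq_bigr => y _; rewrite adj_sym.
  rewrite -mulr2n -(mulr_natl (\sum_x _ * _) 2); congr (_ + _).
  rewrite !mulr_sumr; apply: eq_bigr => x _; rewrite -!mulr_sumr vM; ring.
have degv : \sum_x ((degree x)%:R * v x ^+ 2) <= D * \sum_x v x ^+ 2.
  rewrite mulr_sumr; apply: ler_sum => x _.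
  by rewrite ler_wpM2r ?sqr_ge0 // ler_nat degree_le_max.
have p1 := quad 1 (expr1n _ _); have p2 := quad (-1) (sqrr_sign _ 1).
have bounds (T lQ DQ : R) : T <= DQ -> 0 <= 2 * T + 2 * 1 * lQ ->
    0 <= 2 * T + 2 * (-1) * lQ -> - DQ <= lQ <= DQ.
  by move=> h1 h2 h3; apply/andP; split; lra.
have := bounds _ _ _ degv p1 p2.
by rewrite ler_norml -mulNr !(ler_pM2r v2).
Qed.

(** * From two squared eigenvalues to the structure of the graph, and back *)

Lemma two_squares_structure (b : R) : connected G -> (2 < #|G|)%N ->
  (forall x z, \sum_y codeg x y * (codeg y z - b * (y == z)%:R)
    = D ^+ 2 * (codeg x z - b * (x == z)%:R)) ->
  (exists lam, strongly_regular G lam lam) \/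
  exists (P : {set G}) lam, design_bipartition P (max_degree G) lam.
Proof.
move=> Gconn G3 eigen.
pose K y z := codeg y z - b * (y == z)%:R.
have KE x z : \sum_y codeg x y * K y z = D ^+ 2 * K x z := eigen x z.
have K_sym y z : K y z = K z y by rewrite /K codegree_sym eq_sym.
(* Off the diagonal [K] is free of the unknown [b], so this choice gives a nonzero entry. *)
have [x1 [x0 [x10 cn10]]] := connected_codegree_gt0 Gconn G3.
pose r x : R := \sum_y codeg x y.
have r_le x : r x <= D ^+ 2.
  rewrite /r -natr_sum -natrX ler_nat (leq_trans (sum_codegree_le x)) //.
  by rewrite expnS expn1 leq_mul // degree_le_max.
(* The Dirichlet form of the two-step walk vanishes on the columns of K. *)
have dirichlet z :
    \sum_x \sum_y codeg x y * (K x z - K y z) ^+ 2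
    = - (2 * \sum_x (D ^+ 2 - r x) * K x z ^+ 2).
  have -> : \sum_x \sum_y codeg x y * (K x z - K y z) ^+ 2 =
      \sum_x \sum_y codeg x y * K x z ^+ 2 + \sum_x \sum_y codeg x y * K y z ^+ 2
      - \sum_x \sum_y 2 * K x z * (codeg x y * K y z).
    rewrite -big_split -sumrB; apply: eq_bigr => x _; rewrite -big_split -sumrB.
    by apply: eq_bigr => y _ /=; ring.
  have rE : \sum_x \sum_y codeg x y * K x z ^+ 2 = \sum_x r x * K x z ^+ 2.
    by apply: eq_bigr => x _; rewrite -mulr_suml.
  have -> : \sum_x \sum_y codeg x y * K y z ^+ 2 = \sum_x r x * K x z ^+ 2.
    rewrite exchange_big -rE; apply: eq_bigr => x _; apply: eq_bigr => y _.
    by rewrite codegree_sym.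
  rewrite rE; have -> : \sum_x \sum_y 2 * K x z * (codeg x y * K y z)
      = \sum_x 2 * (D ^+ 2 * K x z ^+ 2).
    by apply: eq_bigr => x _; rewrite -mulr_sumr KE; ring.
  rewrite -big_split -sumrB mulr_sumr -sumrN; apply: eq_bigr => x _ /=; ring.
have dir_ge0 z : 0 <= \sum_x \sum_y codeg x y * (K x z - K y z) ^+ 2.
  by apply: sumr_ge0 => x _; apply: sumr_ge0 => y _; rewrite mulr_ge0 ?ler0n ?sqr_ge0.
have def_ge0 z x : 0 <= (D ^+ 2 - r x) * K x z ^+ 2.
  by rewrite mulr_ge0 ?sqr_ge0 // subr_ge0.
(* The Dirichlet form is nonnegative and equals minus twice a nonnegative sum, so both vanish. *)
have def_sum0 z : \sum_x (D ^+ 2 - r x) * K x z ^+ 2 = 0.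
  apply/le_anti/andP; split; last by apply: sumr_ge0.
  by have := dir_ge0 z; rewrite dirichlet; lra.
have r_eq z x : K x z != 0 -> r x = D ^+ 2.
  move=> KN0; have /eqP := psumr_eq0P (fun x _ => def_ge0 z x) (def_sum0 z) (i := x) isT.
  by rewrite mulf_eq0 sqrf_eq0 (negPf KN0) orbF subr_eq0 => /eqP.
have K_step x y z : (0 < codegree x y)%N -> K x z = K y z.
  move=> xy.
  have dir0 : \sum_x \sum_y codeg x y * (K x z - K y z) ^+ 2 = 0.
    by rewrite dirichlet def_sum0 mulr0 oppr0.
  have in_ge0 u : 0 <= \sum_y codeg u y * (K u z - K y z) ^+ 2.
    by apply: sumr_ge0 => w _; rewrite mulr_ge0 ?ler0n ?sqr_ge0.
  have dirx := psumr_eq0P (fun u _ => in_ge0 u) dir0 (i := x) isT.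
  have term_ge0 w : 0 <= codeg x w * (K x z - K w z) ^+ 2 by rewrite mulr_ge0 ?ler0n ?sqr_ge0.
  have /eqP := psumr_eq0P (fun w _ => term_ge0 w) dirx (i := y) isT.
  by rewrite mulf_eq0 sqrf_eq0 pnatr_eq0 eqn0Ngt xy subr_eq0 => /eqP.
have K_class x y z : connect (@two_steps G) x y -> K x z = K y z.
  move=> /connectP[p pth ->]; elim: p x pth => //= u p IHp x /andP[xu /IHp <-].
  exact: K_step.
have x01 : connect (@two_steps G) x0 x1.
  by apply: connect1; rewrite /two_steps /= codegree_sym.
(* By symmetry [K] is constant on classes in both arguments, hence constant on the class of [x0],
   diagonal included. *)
have K00 y z : connect (@two_steps G) x0 y -> connect (@two_steps G) x0 z ->
    K y z = K x1 x0.
  move=> x0y x0z; rewrite -(K_class x0 y) // K_sym -(K_class x0 z) //.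
  exact: K_class.
have K10 : K x1 x0 = codeg x1 x0 by rewrite /K (negPf x10) mulr0 subr0.
(* A nonzero entry of [K] forces the extreme row sum [Delta ^+ 2] of [M ^+ 2]. The class of [x0]
   together with its neighbours covers [G]. *)
have reg y : connect (@two_steps G) x0 y ->
    degree y = max_degree G /\ forall w, adj y w -> degree w = max_degree G.
  move=> x0y; apply: sum_codegree_max; apply/eqP; rewrite -(eqr_nat R).
  rewrite natr_sum natrM -expr2; apply/eqP/(r_eq x0).
  by rewrite K00 // K10 pnatr_eq0 -lt0n.
have degD y : degree y = max_degree G.
  by have [/reg[]//|[w /reg[_ wD] /wD]] := two_steps_cover Gconn x0 y.
have D0 : (0 < max_degree G)%N by rewrite -(degD x0) connected_degree_gt0 // ltnW.
have [] := @regular_two_steps_classification G Gconn _ (codegree x1 x0) x0 degD D0.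
- move=> y z x0y x0z yz; apply/eqP; rewrite -(eqr_nat R) -K10 -(K00 y z) //.
  by rewrite /K (negPf yz) mulr0 subr0.
- by move=> srg; left; exists (codegree x1 x0).
by move=> [P desP]; right; exists P, (codegree x1 x0).
Qed.

(** The choice [b = k - lam] makes the diagonal of [M ^+ 2 - b] equal to [lam], so its columns are
    multiples of class indicators. These are fixed by [M ^+ 2] up to [k ^+ 2], since its row sums
    are [k ^+ 2] and it never leaves a class. *)
Lemma two_squares_of_classes (k lam : nat) (c : G -> bool) :
  (forall x, degree x = k) ->
  (forall x y, x != y -> codegree x y = if c x == c y then lam else 0%N) ->
  forall x z, \sum_y codeg x y * (codeg y z - (k%:R - lam%:R) * (y == z)%:R)
    = k%:R ^+ 2 * (codeg x z - (k%:R - lam%:R) * (x == z)%:R).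
Proof.
move=> degk codegc x z.
have KE y : codeg y z - (k%:R - lam%:R) * (y == z)%:R = lam%:R * (c y == c z)%:R.
  have [->|yz] := eqVneq y z; first by rewrite codegree_id degk !eqxx !mulr1; ring.
  by rewrite codegc // mulr0 subr0; case: (c y == c z); rewrite ?mulr1 ?mulr0.
under eq_bigr do rewrite KE.
rewrite KE (eq_bigr (fun y => codeg x y * (lam%:R * (c x == c z)%:R))) => [|y _].
  by rewrite -mulr_suml -natr_sum (sum_codegree_regular x degk) natrM.
have [<- //|xy] := eqVneq x y.
by rewrite codegc //; case: (eqVneq (c x) (c y)) => [->|]; rewrite ?mul0r.
Qed.

End AdjacencySpectrum.

(** * The energy bound and its equality cases *)

(** Without non-adjacent pairs [mu] is unconstrained and may be taken equal to [lambda]. *)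
Lemma complete_strongly_regular (G : sgraph) :
  complete G -> strongly_regular G (#|G| - 2) (#|G| - 2).
Proof.
move=> Gcomp.
have NE (x : G) : neighbours x = [set~ x].
  apply/setP => y; rewrite !inE; apply/idP/idP => [|yx].
    by apply: contraTneq => ->; rewrite adj_irrefl.
  by apply: Gcomp; rewrite eq_sym.
have codegE (x y : G) : x != y -> #|neighbours x :&: neighbours y| = (#|G| - 2)%N.
  move=> xy; rewrite !NE -setCU; have := cardsC [set x; y].
  by rewrite cards2 xy => <-; rewrite addKn.
split; first by exists #|G|.-1 => x; rewrite /degree NE cardsC1.
  by move=> x y xy; apply: codegE; apply: contraTneq xy => ->; rewrite adj_irrefl.
by move=> x y xy _; apply: codegE.
Qed.

(* The right-hand side of the bound has the form 0 / 0 exactly when G = K_2. *)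
Theorem theorem1p1 (R : rcfType) (G : sgraph) :
  (1 < #|G|)%N -> connected G ->
  let Delta : R := (max_degree G)%:R in
  let A : R := spectral_moment R G 4 / Delta ^+ 3 in
  let B : R := spectral_moment R G 2 / Delta in
  let C : R := Delta * #|G|%:R in
  let s : R := Num.sqrt (- A + B) * Num.sqrt (- B + C) in
  let bound : R :=
    - ((B ^+ 2 + B * s - C * (A + s)) / (A - 2 * B + C)) in
  (A - 2 * B + C = 0 <-> #|G| = 2%N) /\
  (A - 2 * B + C != 0 ->
     energy R G <= bound /\
     (energy R G = bound <->
        [\/ complete G,
            exists lambda : nat, strongly_regular G lambda lambda
          | is_symmetric_design_graph G])).
Proof.
move=> G2 Gconn Delta A B C s bound.
have [x0 _] : exists x : G, x \in G by apply/card_gt0P; rewrite ltnW.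
have D0 : 0 < Delta.
  by rewrite ltr0n (leq_trans _ (degree_le_max x0)) // connected_degree_gt0.
have sym := @adjacency_mx_sym R G.
have size_eig : size (eigenvalues R G) = #|G| := symmetric_real_spectrum sym.
have [] := energy_moment_bound D0 (@adjacency_spectral_radius R G).
rewrite size_eig -/(spectral_moment R G 4) -/(spectral_moment R G 2).
rewrite -/(energy R G) -/A -/B -/C -/s -/bound => den0 main.
(* The denominator vanishes exactly when [M ^+ 2] is the scalar [Delta ^+ 2]; distinct vertices then
   have no common neighbour. *)
have den_card : A - 2 * B + C = 0 <-> #|G| = 2%N.
  have scal := symmetric_spectrum_square (Delta ^+ 2) sym.
  have codegE := iff_trans (iff_sym scal) (adjacency_mx_square_scalar G (Delta ^+ 2)).
  rewrite den0 codegE {codegE scal}; split=> [codegE|cardG].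
    apply/eqP; rewrite eqn_leq G2 andbT leqNgt; apply/negP => G3.
    have [x [y [xy]]] := connected_codegree_gt0 Gconn G3.
    by rewrite lt0n -(pnatr_eq0 R) codegE (negPf xy) mulr0 eqxx.
  have deg1 (x : G) : degree x = 1%N := card2_degree Gconn x cardG.
  move=> x y; rewrite /Delta (max_degree_regular x deg1) expr1n mul1r.
  have [->|xy] := eqVneq x y; first by rewrite codegree_id deg1.
  by rewrite card2_codegree.
split=> // denN0; have [le_bound eq_bound] := main denN0.
split=> //.
have G3 : (2 < #|G|)%N.
  by rewrite ltn_neqAle G2 andbT eq_sym; apply: contra_neq denN0 => /den_card.
have two_sq b : (forall x, x \in eigenvalues R G -> x ^+ 2 = Delta ^+ 2 \/ x ^+ 2 = b) <->
    forall x z : G, \sum_y (codegree x y)%:R * ((codegree y z)%:R - b * (y == z)%:R)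
      = Delta ^+ 2 * ((codegree x z)%:R - b * (x == z)%:R).
  rewrite -adjacency_mx_two_squares; apply: iff_sym.
  by have [_] := symmetric_spectrum_two_squares (Delta ^+ 2) b sym.
rewrite eq_bound; split=> [[b /two_sq eigen]|].
  have [srg|[P [lam des]]] := two_squares_structure Gconn G3 eigen.
    exact: Or32.
  exact: Or33 (design_bipartition_incidence des).
have of_classes k lam (c : G -> bool) : (forall x : G, degree x = k) ->
    (forall x y : G, x != y -> codegree x y = if c x == c y then lam else 0%N) ->
    exists b, forall x, x \in eigenvalues R G -> x ^+ 2 = Delta ^+ 2 \/ x ^+ 2 = b.
  move=> degk codegc; exists (k%:R - lam%:R); apply/two_sq.
  by rewrite /Delta (max_degree_regular x0 degk); exact: (two_squares_of_classes R degk codegc).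
have of_srg lam : strongly_regular G lam lam ->
    exists b, forall x, x \in eigenvalues R G -> x ^+ 2 = Delta ^+ 2 \/ x ^+ 2 = b.
  (* One class: since [lambda = mu], adjacency does not affect the codegree. *)
  move=> [[k degk] adj_lam nadj_lam]; apply: (of_classes k lam xpredT) => // x y xy.
  rewrite eqxx; have [xy_adj|xy_nadj] := boolP (adj x y); first exact: adj_lam.
  exact: nadj_lam.
move=> [/complete_strongly_regular/of_srg //|[lam /of_srg //]|].
move=> [X [F [blk [v [k [lam [/incidence_design_bipartition[P' des'] [f f_bij f_adj]]]]]]]].
have des := iso_design_bipartition f_bij f_adj des'.
have degk := design_bipartition_regular Gconn G3 des.
(* Two classes, points and blocks. The axioms give the codegrees of points; those of blocks come
   from [design_block_codegree]. *)
apply: (of_classes k lam (fun x => x \in f @^-1: P')) => // x y xy.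
have [_ cross _ codegP] := des.
case: eqP => [xyP|/eqP]; last exact: bipartite_codegree0.
have [xP|xP] := boolP (x \in f @^-1: P').
  by apply: codegP => //; rewrite -xyP.
by apply: (design_block_codegree Gconn des) => //; rewrite -[y \in _]xyP.
Qed.
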